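(* Let $p\in\{2,3\}$. Then Dedekind sums do not approximate any $u\in\mathbb{Z}_p^{\times}$ (in $\mathbb{Q}_p$).
   Context: $\mathbb{N}$ denotes the positive integers. For a natural number $n\ge 1$ and an integer $m$ with $\gcd(m,n)=1$, the classical Dedekind sum is $s(m,n)=\sum_{k=1}^n ((k/n))((mk/n))$, where $((t))=t-\lfloor t\rfloor-1/2$ if $t\in\mathbb{R}\setminus\mathbb{Z}$ and $((t))=0$ if $t\in\mathbb{Z}$. Put $S(m,n)=12\,s(m,n)$; this is a rational number and $S(m+n,n)=S(m,n)$. For a prime $p$, $\mathbb{Q}_p$ is the field of $p$-adic numbers, $\mathbb{Z}_p$ the ring of $p$-adic integers, $\mathbb{Z}_p^{\times}$ its unit group. For $a\in\mathbb{Q}_p$ and a subset $M\subseteq\mathbb{Q}_p$, we say that $M$ approximates $a$ (in $\mathbb{Q}_p$) if for every integer $k\ge 1$ there are $x\in M$ and $b\in\mathbb{Z}_p$ with $a=x+p^k b$. ''Dedekind sums approximate $a$ (in $\mathbb{Q}_p$)'' means that the set $M=\{S(m,n): n\in\mathbb{N},\ 0\le m<n,\ \gcd(m,n)=1\}$ approximates $a$ in $\mathbb{Q}_p$. *)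

(* Defs.v *)
From HB Require Import structures.
From mathcomp Require Import all_boot all_order all_algebra.
From mathcomp Require Import boolp classical_sets.
From mathcomp Require Import zify.

Set Implicit Arguments.
Unset Strict Implicit.
Unset Printing Implicit Defensive.

Import Order.TTheory GRing.Theory Num.Theory.
Local Open Scope ring_scope.

(* The ring Z_p as the inverse limit of the rings Z/p^k: [residue x k] is the
   representative in {0, ..., p^k - 1} of the class of x modulo p^k (the bound
   residue x k < p^k follows from the coherence condition).  The primality proof
   is a parameter so that every instance of the type is an integral domain. *)
Record padic_int (p : nat) (p_pr : prime p) := PadicInt {
  residue : nat -> nat;
  residue_coherent : forall k, (residue k.+1 %% p ^ k)%N = residue k
}.

Section PadicInt.
Variables (p : nat) (p_pr : prime p).
Local Notation Zp := (padic_int p_pr).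
Implicit Types x y z : Zp.

HB.instance Definition _ := gen_eqMixin Zp.
HB.instance Definition _ := gen_choiceMixin Zp.

Lemma padic_int_ext x y : (forall k, residue x k = residue y k) -> x = y.
Proof.
case: x y => [f cf] [g cg] /= fg.
have {}fg : f = g by apply: funext.
by subst g; congr PadicInt; apply: Prop_irrelevance.
Qed.

Lemma residue_modn x k : (residue x k %% p ^ k)%N = residue x k.
Proof. by rewrite -{1}residue_coherent modn_mod residue_coherent. Qed.

Lemma residue_leq x j k : (j <= k)%N -> (residue x k %% p ^ j)%N = residue x j.
Proof.
move=> jk; rewrite -(subnK jk); elim: (k - j)%N => [|n IHn].
  exact: residue_modn.
rewrite addSn -IHn -[in RHS](residue_coherent x (n + j)).
by rewrite modn_dvdm // dvdn_exp2l // leq_addl.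
Qed.

Lemma padic_of_seq_subproof (f : nat -> nat) :
  (forall k, f k.+1 = f k %[mod p ^ k]) ->
  forall k, ((f k.+1 %% p ^ k.+1) %% p ^ k = f k %% p ^ k)%N.
Proof. by move=> fP k; rewrite modn_dvdm ?dvdn_exp2l. Qed.

Definition padic_of_seq (f : nat -> nat)
    (fP : forall k, f k.+1 = f k %[mod p ^ k]) : Zp :=
  @PadicInt p p_pr (fun k => f k %% p ^ k)%N (padic_of_seq_subproof fP).

Definition padic_const (n : nat) : Zp :=
  @padic_of_seq (fun=> n) (fun=> erefl).

Lemma padic_add_subproof x y k :
  residue x k.+1 + residue y k.+1 = residue x k + residue y k %[mod p ^ k].
Proof. by rewrite -modnDm !residue_coherent. Qed.

Definition padic_add x y : Zp := padic_of_seq (padic_add_subproof x y).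

Lemma padic_mul_subproof x y k :
  residue x k.+1 * residue y k.+1 = residue x k * residue y k %[mod p ^ k].
Proof. by rewrite -modnMm !residue_coherent. Qed.

Definition padic_mul x y : Zp := padic_of_seq (padic_mul_subproof x y).

Lemma residue_lt x k : (residue x k < p ^ k)%N.
Proof. by rewrite -residue_modn ltn_pmod // expn_gt0 prime_gt0. Qed.

Lemma padic_opp_subproof x k :
  (p ^ k.+1 - residue x k.+1 = p ^ k - residue x k %[mod p ^ k])%N.
Proof.
apply/eqP; rewrite -(eqn_modDr (residue x k)) subnK; last exact/ltnW/residue_lt.
rewrite -(residue_coherent x k) modnDmr subnK; last exact/ltnW/residue_lt.
by rewrite modnn -/(dvdn _ _) dvdn_exp2l.
Qed.

Definition padic_opp x : Zp := padic_of_seq (padic_opp_subproof x).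

Lemma padic_addA : associative padic_add.
Proof.
move=> x y z; apply: padic_int_ext => k /=.
by rewrite modnDmr modnDml addnA.
Qed.

Lemma padic_addC : commutative padic_add.
Proof. by move=> x y; apply: padic_int_ext => k /=; rewrite addnC. Qed.

Lemma padic_add0 : left_id (padic_const 0) padic_add.
Proof. by move=> x; apply: padic_int_ext => k /=; rewrite mod0n residue_modn. Qed.

Lemma padic_addN : left_inverse (padic_const 0) padic_opp padic_add.
Proof.
move=> x; apply: padic_int_ext => k /=.
by rewrite modnDml subnK ?modnn ?mod0n //; exact/ltnW/residue_lt.
Qed.

HB.instance Definition _ :=
  GRing.isZmodule.Build Zp padic_addA padic_addC padic_add0 padic_addN.

Lemma padic_mulA : associative padic_mul.
Proof.
move=> x y z; apply: padic_int_ext => k /=.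
by rewrite modnMmr modnMml mulnA.
Qed.

Lemma padic_mulC : commutative padic_mul.
Proof. by move=> x y; apply: padic_int_ext => k /=; rewrite mulnC. Qed.

Lemma padic_mul1 : left_id (padic_const 1) padic_mul.
Proof.
by move=> x; apply: padic_int_ext => k /=; rewrite modnMml mul1n residue_modn.
Qed.

Lemma padic_mulDl : left_distributive padic_mul padic_add.
Proof.
by move=> x y z; apply: padic_int_ext => k /=; rewrite modnMml mulnDl modnDm.
Qed.

Lemma padic_oner_neq0 : padic_const 1 != padic_const 0.
Proof.
apply/eqP => /(congr1 (fun x => residue x 1)) /=.
by rewrite expn1 mod0n modn_small ?prime_gt1.
Qed.

HB.instance Definition _ := GRing.Zmodule_isComNzRing.Build Zp
  padic_mulA padic_mulC padic_mul1 padic_mulDl padic_oner_neq0.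

Definition padic_unit : {pred Zp} := fun x => `[< exists y, y * x = 1 >].

Definition padic_inv x : Zp :=
  if pselect (exists y, y * x = 1) is left h then projT1 (cid h) else x.

Lemma padic_mulVx : {in padic_unit, left_inverse 1 padic_inv *%R}.
Proof.
move=> x /asboolP ux; rewrite /padic_inv.
by case: pselect => // h; exact: (projT2 (cid h)).
Qed.

Lemma padic_unitPl x y : y * x = 1 -> padic_unit x.
Proof. by move=> yx; apply/asboolP; exists y. Qed.

Lemma padic_invr_out : {in [predC padic_unit], padic_inv =1 id}.
Proof.
move=> x /negP ux; rewrite /padic_inv.
by case: pselect => // h; case: ux; apply/asboolP.
Qed.

HB.instance Definition _ := GRing.ComNzRing_hasMulInverse.Build Zp
  padic_mulVx padic_unitPl padic_invr_out.

Lemma padic_neq0 x : x != 0 -> exists k, residue x k != 0%N.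
Proof.
move=> x0; apply: contrapT => nk; case/eqP: x0; apply: padic_int_ext => k.
rewrite [RHS]/= mod0n; apply/eqP/negP => /negP xk.
by apply: nk; exists k.
Qed.

Lemma residue_logn x i k : residue x i != 0%N -> (i <= k)%N ->
  (0 < residue x k)%N /\ (logn p (residue x k) < i)%N.
Proof.
move=> xi ik.
have xk0 : (0 < residue x k)%N.
  rewrite lt0n; apply: contra xi => /eqP xk.
  by rewrite -(residue_leq x ik) xk mod0n.
split=> //; rewrite ltnNge -pfactor_dvdn //.
by rewrite /dvdn residue_leq.
Qed.

Lemma padic_integral : GRing.integral_domain_axiom Zp.
Proof.
move=> x y xy; apply/norP => -[/padic_neq0 [i xi] /padic_neq0 [j yj]].
have [x0 vx] := residue_logn xi (leq_addr j i).
have [y0 vy] := residue_logn yj (leq_addl i j).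
have := congr1 (fun z => residue z (i + j)) xy.
rewrite /= mod0n => /eqP; rewrite -/(dvdn _ _).
by rewrite pfactor_dvdn ?muln_gt0 ?x0 // lognM //; lia.
Qed.

HB.instance Definition _ := GRing.ComUnitRing_isIntegral.Build Zp padic_integral.

Lemma residue_natr n k : residue (n%:R : Zp) k = (n %% p ^ k)%N.
Proof.
elim: n => [|n IHn]; first by [].
by rewrite -addn1 natrD [LHS]/= IHn modnDm.
Qed.

Lemma padic_natr_eq0 n : (n%:R == 0 :> {fraction Zp}) = (n == 0%N).
Proof.
rewrite -[n%:R](rmorph_nat (FracField.tofrac (R := Zp))) tofrac_eq0.
apply/eqP/eqP => [n0|->//]; have := residue_natr n n.
by rewrite n0 /= mod0n modn_small // ltn_expl ?prime_gt1.
Qed.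

End PadicInt.

(* Q_p is the field of fractions of Z_p. *)
Notation padic p_pr := {fraction padic_int p_pr}.

Notation "x %:F" := (FracField.tofrac x) : ring_scope.

Definition sawtooth (R : archiRealFieldType) (t : R) : R :=
  if t \is a Num.int then 0 else t - (Num.floor t)%:~R - 2%:R^-1.

(* The classical Dedekind sum; all its terms are rational. *)
Definition dedekind_s (m : int) (n : nat) : rat :=
  \sum_(1 <= k < n.+1)
    sawtooth (k%:R / n%:R : rat) * sawtooth (m%:~R * k%:R / n%:R : rat).

Definition dedekind_S (m : int) (n : nat) : rat := 12%:R * dedekind_s m n.

Local Open Scope classical_set_scope.

(* [ratr] is the embedding of Q into Q_p, a field of characteristic 0
   (see [padic_natr_eq0]). *)
Definition dedekind_values (p : nat) (p_pr : prime p) : set (padic p_pr) :=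
  [set x | exists (n m : nat), [/\ (0 < n)%N, (m < n)%N, coprime m n &
                                x = ratr (dedekind_S m%:Z n)]].
Arguments dedekind_values {p} p_pr.

Definition approximates (p : nat) (p_pr : prime p)
    (M : set (padic p_pr)) (a : padic p_pr) : Prop :=
  forall k : nat, (1 <= k)%N ->
    exists (x : padic p_pr) (b : padic_int p_pr),
      M x /\ a = x + p%:R ^+ k * b%:F.

(* Main.v *)
Require Import Defs.
From mathcomp Require Import all_boot all_order all_algebra.
From mathcomp Require Import boolp classical_sets.
From mathcomp Require Import zify ring lra.

(** Write S for [dedekind_S m n], with m prime to n.  Congruence to a unit u
    modulo p already forces S, viewed in Q_p, to be a unit of Z_p, so it is
    enough to show that S is never a 2-adic or 3-adic unit.

    Let T be the sum of k * (m k mod n) ([remainder_sum]) and Q the sum of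
    (m k / n)^2 with integer quotients ([quotient_sum]), for 0 <= k < n.  Expanding the sawtooth functions gives

      n^2 S = 12 T - 3 n^2 (n - 1)    ([dedekind_S_remainder_sum]),

    and, since k |-> m k mod n permutes the residues, expanding the squares of
    n (m k / n) = m k - (m k mod n) gives a second expression of T, whence

      m n S = (m^2 + 1) (n - 1) (2 n - 1) - 6 n Q - 3 m n (n - 1)

    ([dedekind_S_quotient_sum]).

    If p does not divide n, the first identity shows that p divides S (for
    p = 2 because n - 1 is even).  If 3 | n, the right-hand side of the second
    identity is congruent to m^2 + 1, hence prime to 3, and S has a denominator
    divisible by 3.  If 4 | n, the right-hand side is 2 modulo 4, so S has an
    even denominator.  Finally, if n is 2 modulo 4, then m n is 2 modulo 4 while
    the right-hand side is 0 modulo 4, so S is even.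

    The transfer from these identities in Q to Q_p is [padic_unit_dvd]: in a
    relation d q = a with q a p-adic unit, the integers d and a are divisible by
    the same powers of p. *)

Set Implicit Arguments.
Unset Strict Implicit.
Unset Printing Implicit Defensive.

Import Order.TTheory GRing.Theory Num.Theory.
Local Open Scope ring_scope.

(** * Two integrality identities for Dedekind sums *)

(** Multiplication by m permutes the residues modulo n. *)
Lemma sum_mulmod (V : nmodType) (m n : nat) (f : nat -> V) :
  coprime m n -> \sum_(k < n) f ((m * k) %% n)%N = \sum_(k < n) f k.
Proof.
case: n => [|n] cmn; first by rewrite !big_ord0.
pose h (k : 'I_n.+1) : 'I_n.+1 := inord ((m * k) %% n.+1).
have hE k : h k = ((m * k) %% n.+1)%N :> nat by rewrite inordK // ltn_pmod.
have h_inj : injective h.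
  move=> i j /(congr1 val) /=; rewrite !hE => /eqP.
  wlog le_ij : i j / (i <= j)%N => [IH|].
    by case/orP: (leq_total i j) => [/IH//|/IH ji]; rewrite eq_sym => /ji ->.
  rewrite eq_sym eqn_mod_dvd ?leq_mul // -mulnBr Gauss_dvdr; last first.
    by rewrite coprime_sym.
  move=> dv; apply/val_inj/eqP; rewrite /= eqn_leq le_ij /= -subn_eq0.
  apply/negPn; rewrite -lt0n; apply/negP => /dvdn_leq /(_ dv).
  by case: (j) => /= ? ?; lia.
rewrite [RHS](reindex_inj h_inj) /=.
by apply: eq_bigr => k _; rewrite hE.
Qed.

Lemma sum_id (n : nat) : 2 * \sum_(k < n) k%:Z = n%:Z * (n%:Z - 1).
Proof. by elim: n => [|n IH]; rewrite ?big_ord0 // big_ord_recr /= mulrDr IH; lia. Qed.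

Lemma sum_sqr (n : nat) :
  6 * \sum_(k < n) k%:Z ^+ 2 = n%:Z * (n%:Z - 1) * (2 * n%:Z - 1).
Proof.
elim: n => [|n IH]; first by rewrite big_ord0.
by rewrite big_ord_recr /= mulrDr IH intS; ring.
Qed.

Definition remainder_sum (m n : nat) : int :=
  \sum_(k < n) k%:Z * ((m * k) %% n)%N%:Z.

Definition quotient_sum (m n : nat) : int :=
  \sum_(k < n) ((m * k) %/ n)%N%:Z ^+ 2.

Lemma sawtooth_frac (R : archiRealFieldType) (a n : nat) :
  (0 < n)%N -> ~~ (n %| a)%N ->
  sawtooth (a%:R / n%:R : R) = (a %% n)%N%:R / n%:R - 2^-1.
Proof.
move=> n0 nda; have n0R : (0 : R) < n%:R by rewrite ltr0n.
have aE : a%:R / n%:R = (a %/ n)%N%:R + (a %% n)%N%:R / n%:R :> R.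
  by rewrite {1}(divn_eq a n) natrD natrM mulrDl mulfK ?gt_eqF.
have r0 : (0 : R) < (a %% n)%N%:R / n%:R by rewrite divr_gt0 // ltr0n lt0n.
have r1 : (a %% n)%N%:R / n%:R < 1 :> R by rewrite ltr_pdivrMr // mul1r ltr_nat ltn_pmod.
have fl : Num.floor (a%:R / n%:R : R) = (a %/ n)%N.
  by apply: floor_def; rewrite aE -natz intrD !mulrz_nat; apply/andP; split; lra.
rewrite /sawtooth ifF.
  by rewrite fl aE; ring.
apply/negP; rewrite intrEfloor fl aE => /eqP.
by move=> e; move: r0; rewrite -(ltrD2l ((a %/ n)%N%:R)) -e addr0 ltxx.
Qed.

Lemma dedekind_S_remainder_sum (m n : nat) : (0 < n)%N -> coprime m n ->
  (n%:Z ^+ 2)%:~R * dedekind_S m n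
    = (12 * remainder_sum m n - 3 * n%:Z ^+ 2 * (n%:Z - 1))%:~R.
Proof.
move=> n0 cmn; have n0Q : n%:R != 0 :> rat by rewrite pnatr_eq0; lia.
pose f k : rat := (k%:R / n%:R - 2^-1) * (((m * k) %% n)%N%:R / n%:R - 2^-1).
(* The term k = n of the Dedekind sum vanishes, and 1/4 is the value of f at
   k = 0, where the sawtooth function is 0 instead of -1/2. *)
have S0 : dedekind_s m n = \sum_(k < n) f k - 4^-1.
  rewrite /dedekind_s big_nat_recr //= divff // {3}/sawtooth int_num1 mul0r addr0.
  rewrite -(big_mkord xpredT f) [in RHS]big_ltn //.
  have -> : f 0%N = 4^-1 by rewrite /f muln0 mod0n mul0r.
  rewrite addrC addKr; apply: eq_big_nat => k /andP[k0 kn].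
  have nk : ~~ (n %| k)%N by rewrite gtnNdvd.
  rewrite -[m%:~R]/(m%:R) -natrM !sawtooth_frac //; first by rewrite (modn_small kn).
  by rewrite Gauss_dvdr // coprime_sym.
pose g k : int := 4 * (k%:Z * ((m * k) %% n)%N%:Z) - 2 * n%:Z * k%:Z
  - 2 * n%:Z * ((m * k) %% n)%N%:Z + n%:Z ^+ 2.
have fE k : 4 * n%:R ^+ 2 * f k = (g k)%:~R.
  by rewrite /f /g !(intrD, intrM, intrN) -!pmulrn; field.
have sum_g : \sum_(k < n) g k
    = 4 * remainder_sum m n - 2 * n%:Z ^+ 2 * (n%:Z - 1) + n%:Z ^+ 3.
  rewrite !big_split /= !sumrN -!mulr_sumr.
  rewrite -/(remainder_sum m n) (sum_mulmod Posz cmn) sumr_const card_ord.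
  rewrite -[_ *+ n]mulr_natr natz; have := sum_id n.
  set s1 := \sum_(i < n) _ => e1.
  rewrite -[RHS]addr0 -(subrr (2 * n%:Z * (2 * s1))) {1}e1; ring.
have e2 : 4 * n%:R ^+ 2 * \sum_(k < n) f k = (\sum_(k < n) g k)%:~R.
  by rewrite mulr_sumr rmorph_sum; apply: eq_bigr => k _; apply: fE.
have -> : (n%:Z ^+ 2)%:~R * dedekind_S m n
  = 3 * (4 * n%:R ^+ 2 * \sum_(i < n) f i) - 3 * n%:R ^+ 2.
  by rewrite /dedekind_S S0 intrM -pmulrn; field.
by rewrite e2 sum_g !(intrD, intrM, intrN) -!pmulrn; ring.
Qed.

(** Expand (n * ((m k) / n))^2 = (m k - (m k mod n))^2 and sum over k: the
    squares of the remainders add up to the sum of all k^2. *)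
Lemma quotient_remainder_sum (m n : nat) : coprime m n ->
  n%:Z ^+ 2 * quotient_sum m n + 2 * m%:Z * remainder_sum m n
    = (m%:Z ^+ 2 + 1) * \sum_(k < n) k%:Z ^+ 2.
Proof.
move=> cmn; rewrite [in RHS]mulrDl mul1r.
rewrite -[X in _ = _ + X](sum_mulmod (fun k => k%:Z ^+ 2) cmn).
rewrite /quotient_sum /remainder_sum !mulr_sumr -!big_split /=.
apply: eq_bigr => k _.
have := congr1 Posz (divn_eq (m * k) n); rewrite PoszD !PoszM => e.
have -> : m%:Z ^+ 2 * k%:Z ^+ 2 = (m%:Z * k%:Z) ^+ 2 by ring.
have -> : 2 * m%:Z * (k%:Z * ((m * k) %% n)%N%:Z)
        = 2 * (m%:Z * k%:Z) * ((m * k) %% n)%N%:Z by ring.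
by rewrite e; ring.
Qed.

(** Eliminate [remainder_sum] between the two previous identities; a factor n
    cancels. *)
Lemma dedekind_S_quotient_sum (m n : nat) : (0 < n)%N -> coprime m n ->
  (m%:Z * n%:Z)%:~R * dedekind_S m n
    = ((m%:Z ^+ 2 + 1) * (n%:Z - 1) * (2 * n%:Z - 1)
       - 6 * n%:Z * quotient_sum m n - 3 * m%:Z * n%:Z * (n%:Z - 1))%:~R.
Proof.
move=> n0 cmn; have n0Q : n%:~R != 0 :> rat by rewrite intr_eq0; lia.
apply: (mulfI n0Q); rewrite mulrA -!intrM.
have -> : n%:Z * (m%:Z * n%:Z) = m%:Z * n%:Z ^+ 2 by ring.
rewrite intrM -[LHS]mulrA dedekind_S_remainder_sum // -intrM; congr (_%:~R).
have eT := quotient_remainder_sum cmn; have eS := sum_sqr n.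
have -> : m%:Z * (12 * remainder_sum m n - 3 * n%:Z ^+ 2 * (n%:Z - 1))
  = 6 * (n%:Z ^+ 2 * quotient_sum m n + 2 * m%:Z * remainder_sum m n)
    - 6 * n%:Z ^+ 2 * quotient_sum m n - 3 * m%:Z * n%:Z ^+ 2 * (n%:Z - 1) by ring.
rewrite eT mulrCA eS; ring.
Qed.

(** * Rational numbers that are p-adic units *)

Section PadicRational.
Variables (p : nat) (p_pr : prime p).
Local Notation Zp := (padic_int p_pr).

(** Here and below, units enter only through their first residue being nonzero:
    unlike invertibility, this is visibly stable under congruence modulo p. *)
Lemma residue_unit_sub (u b : Zp) :
  u \is a GRing.unit -> residue (u - p%:R * b) 1 != 0%N.
Proof.
move=> uu; apply/eqP => w0.
have /(congr1 (fun x : Zp => residue x 1)) : (u - p%:R * b + p%:R * b) * u^-1 = 1.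
  by rewrite subrK divrr.
move: (u - _) w0 => w w0; rewrite /= w0 residue_natr expn1 modnn !(mul0n, mod0n, addn0).
by rewrite modn_small ?prime_gt1.
Qed.

(** The residue of w modulo p^j is prime to p, hence can be cancelled. *)
Lemma padic_dvd_int (z : int) (w y : Zp) (j : nat) :
  residue w 1 != 0%N -> z%:~R * w = (p ^ j)%:R * y -> (p ^ j %| `|z|)%N.
Proof.
move=> w1 zy; have {zy}: `|z|%N%:R * w = (p ^ j)%:R * (((-1) ^+ (z < 0)%R) * y).
  rewrite mulrCA -zy mulrA; congr (_ * _).
  by rewrite {3}[z]intEsign rmorphM rmorph_sign /= signrMK.
move=> /(congr1 (fun x : Zp => residue x j)).
rewrite /= !residue_natr modnn mul0n mod0n modnMml => /eqP.
case: j => [|j]; first by rewrite expn0 dvd1n.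
rewrite -/(dvdn _ _) Gauss_dvdl // coprimeXl // prime_coprime //.
apply: contra w1 => /dvdnP [c cE].
by rewrite -(residue_leq w (ltn0Sn j)) cE expn1 modnMl.
Qed.

Lemma padic_intr_neq0 (z : int) : z != 0 -> z%:~R != 0 :> padic p_pr.
Proof.
move=> z0; rewrite [z]intEsign rmorphM rmorph_sign /= mulf_neq0 ?signr_eq0 //.
by rewrite -pmulrn padic_natr_eq0 absz_eq0.
Qed.

(** Q_p is not an ordered field, so that [ratr] is not known to be a morphism
    into it; the relation is checked on numerators and denominators. *)
Lemma padic_ratr_eq (q : rat) (d a : int) (w : Zp) :
  d%:~R * q = a%:~R -> ratr q = w%:F -> d%:~R * w = a%:~R.
Proof.
move=> dq qw; apply/eqP; rewrite -tofrac_eq rmorphM !rmorph_int /= -qw.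
have den0 : (denq q)%:~R != 0 :> padic p_pr by rewrite padic_intr_neq0 ?denq_neq0.
rewrite /ratr mulrA -(inj_eq (mulIf den0)) divfK // -!intrM; apply/eqP.
congr (_%:~R); apply: (@intr_inj rat); rewrite !intrM -dq -mulrA; congr (_ * _).
by rewrite -{2}[q]divq_num_den divfK // intr_eq0 denq_neq0.
Qed.

(** A unit has valuation 0, so multiplying by it preserves divisibility by
    every power of p. *)
Lemma padic_unit_dvd (q : rat) (d a : int) (w : Zp) (j : nat) :
  residue w 1 != 0%N -> ratr q = w%:F -> d%:~R * q = a%:~R ->
  ((p ^ j)%N%:Z %| d)%Z = ((p ^ j)%N%:Z %| a)%Z.
Proof.
move=> uw qw /padic_ratr_eq /(_ qw) dw.
apply/idP/idP => /dvdzP [e eE]; rewrite dvdzE /=.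
  have one1 : residue (1 : Zp) 1 != 0%N.
    by rewrite (residue_natr p_pr 1) expn1 modn_small ?prime_gt1.
  apply: (padic_dvd_int (y := e%:~R * w) one1).
  by rewrite -dw eE intrM -pmulrn; ring.
by apply: (padic_dvd_int (y := e%:~R) uw); rewrite dw eE intrM -pmulrn mulrC.
Qed.

End PadicRational.

(** * Dedekind sums are neither 2-adic nor 3-adic units *)

Lemma dedekind_S_not_2unit (p_pr : prime 2) (m n : nat) (w : padic_int p_pr) :
  (0 < n)%N -> coprime m n -> residue w 1 != 0%N ->
  ratr (dedekind_S m n) <> w%:F.
Proof.
move=> n0 cmn uw Sw.
have dvd j d a := @padic_unit_dvd _ p_pr _ d a w j uw Sw.
have e1 := dedekind_S_remainder_sum n0 cmn.
have e2 := dedekind_S_quotient_sum n0 cmn.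
have [n_odd | n_even] := boolP (odd n).
  have [c nE] : exists c : int, n%:Z = 2 * c + 1.
    by exists n./2; move: (odd_double_half n); lia.
  have := dvd 1%N _ _ e1; rewrite nE expn1 => {}dvd.
  have : (2 %| 12 * remainder_sum m n - 3 * (2 * c + 1) ^+ 2 * (2 * c + 1 - 1))%Z.
    apply/dvdzP; exists (6 * remainder_sum m n - 3 * (2 * c + 1) ^+ 2 * c); ring.
  rewrite -dvd => /dvdzP [q].
  have -> : (2 * c + 1) ^+ 2 = 2 * (2 * c ^+ 2 + 2 * c) + 1 by ring.
  lia.
have [a nE] : exists a : int, n%:Z = 2 * a.
  by exists n./2; move: (odd_double_half n); lia.
have [l mE] : exists l : int, m%:Z = 2 * l + 1.
  have m_odd : odd m by rewrite -coprimen2; apply: coprime_dvdr cmn; lia.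
  by exists m./2; move: (odd_double_half m); lia.
have := dvd 2%N _ _ e2; rewrite nE mE; set Q := quotient_sum m n => {}dvd.
have [c [aE|aE]] : exists c : int, a = 2 * c \/ a = 2 * c + 1.
  by exists (a %/ 2)%Z; lia.
- (* n = 4 c: the right-hand side of e2 is 2 modulo 4. *)
  have : (4 %| (2 * l + 1) * (2 * a))%Z.
    by apply/dvdzP; exists ((2 * l + 1) * c); rewrite aE; ring.
  rewrite dvd => /dvdzP [q].
  rewrite aE; set A := (X in X = _) => qE.
  have : A = 4 * (((l ^+ 2 + l) * (4 * c - 1) * (8 * c - 1))
     + (16 * c ^+ 2 - 6 * c) - 6 * c * Q - 3 * (2 * l + 1) * c * (4 * c - 1)) + 2.
    by rewrite /A; ring.
  lia.
(* n = 4 c + 2: the right-hand side of e2 is divisible by 4, but m n is not. *)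
have : (4 %| ((2 * l + 1) ^+ 2 + 1) * (2 * a - 1) * (2 * (2 * a) - 1)
   - 6 * (2 * a) * Q - 3 * (2 * l + 1) * (2 * a) * (2 * a - 1))%Z.
  apply/dvdzP; rewrite aE.
  exists ((l ^+ 2 + l) * (4 * c + 1) * (8 * c + 3) - 3 * (2 * c + 1) * Q
    + (4 * c + 1) * (c - 6 * l * c - 3 * l)).
  ring.
rewrite -dvd => /dvdzP [q].
have -> : (2 * l + 1) * (2 * a) = 4 * (l * a + c) + 2 by rewrite aE; ring.
lia.
Qed.

Lemma dedekind_S_not_3unit (p_pr : prime 3) (m n : nat) (w : padic_int p_pr) :
  (0 < n)%N -> coprime m n -> residue w 1 != 0%N ->
  ratr (dedekind_S m n) <> w%:F.
Proof.
move=> n0 cmn uw Sw.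
have dvd d a := @padic_unit_dvd _ p_pr _ d a w 1 uw Sw.
have e1 := dedekind_S_remainder_sum n0 cmn.
have e2 := dedekind_S_quotient_sum n0 cmn.
have sqr3 (x : int) : ~~ (3 %| x)%Z -> exists y, x ^+ 2 = 3 * y + 1.
  move=> x3; have [c [->|->]] : exists c, x = 3 * c + 1 \/ x = 3 * c - 1.
    by exists ((x + 1) %/ 3)%Z; lia.
  - by exists (3 * c ^+ 2 + 2 * c); ring.
  - by exists (3 * c ^+ 2 - 2 * c); ring.
have [n3 | n3] := boolP (3 %| n)%N.
  have [a nE] : exists a : int, n%:Z = 3 * a by exists (n %/ 3)%N; lia.
  have [y yE] : exists y, m%:Z ^+ 2 = 3 * y + 1.
    apply: sqr3; rewrite dvdzE /=; apply/negP => m3.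
    by have := dvdn_gcd 3 m n; rewrite m3 n3 (eqP cmn).
  have : (3 %| m%:Z * n%:Z)%Z by apply/dvdzP; exists (m%:Z * a); rewrite nE; ring.
  rewrite (dvd _ _ e2) => /dvdzP [q]; rewrite yE nE.
  set Q := quotient_sum m n; set A := (X in X = _) => qE.
  have : A = 3 * (y * (3 * a - 1) * (6 * a - 1) + 2 * (6 * a ^+ 2 - 3 * a)
    - 6 * a * Q - 3 * m%:Z * a * (3 * a - 1)) + 2 by rewrite /A; ring.
  lia.
have [y yE] := sqr3 n n3.
have : (3 %| 12 * remainder_sum m n - 3 * n%:Z ^+ 2 * (n%:Z - 1))%Z.
  by apply/dvdzP; exists (4 * remainder_sum m n - n%:Z ^+ 2 * (n%:Z - 1)); ring.
rewrite -(dvd _ _ e1) => /dvdzP [q]; rewrite yE; lia.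
Qed.

Theorem theorem2 (p : nat) (p_pr : prime p) (p23 : p = 2%N \/ p = 3%N)
    (u : padic_int p_pr) (u_unit : u \is a GRing.unit) :
  ~ approximates (dedekind_values p_pr) (u%:F).
Proof.
move=> /(_ 1%N isT) [_ [b [[n [m [n0 _ cmn ->]]]]]].
rewrite expr1 => uE.
have uw := residue_unit_sub b u_unit; move: uw.
have Sw : ratr (dedekind_S m n) = (u - p%:R * b)%:F.
  by rewrite rmorphB rmorphM rmorph_nat /= uE addrK.
case: p23 => ?; subst p => uw.
- exact: dedekind_S_not_2unit n0 cmn uw Sw.
- exact: dedekind_S_not_3unit n0 cmn uw Sw.
Qed.
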